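(* Let $K$ be a field and let $A$ and $B$ be simple finitely generated $K$-algebras that are Morita equivalent. Then $\operatorname{fdim}(A)=\operatorname{fdim}(B)$; that is, Morita equivalent simple finitely generated algebras have the same filter dimension.
   Context: Algebras are associative unital $K$-algebras; modules are left modules. Let $\mathbb{N}=\{0,1,\ldots\}$. Degree: for a function $f:\mathbb{N}\to\mathbb{N}\cup\{\infty\}$, its degree is the non-negative real number or $\infty$ given by $\gamma(f):=\inf\{r\in\mathbb{R},\ r\ge 0 \mid f(i)\le i^r \text{ for all } i\gg 0\}$ (with $\inf\emptyset=\infty$). Standard filtrations: let $A=K\langle a_1,\ldots,a_s\rangle$ be a finitely generated $K$-algebra. The standard filtration $F=\{A_i\}_{i\ge 0}$ of $A$ associated with the generators $a_1,\dots,a_s$ is $A_0:=K$, $A_1:=K+\sum_{j=1}^s Ka_j$, $A_i:=A_1^i$ (the linear span of products of $i$ elements of $A_1$). If $M=AM_0$ is a finitely generated $A$-module with finite dimensional generating subspace $M_0$, the standard filtration of $M$ is $M_i:=A_iM_0$. Filter dimension: for such $A$, $F$, $M$, $M_0$, the return function is $\nu_{F,M_0}:\mathbb{N}\to\mathbb{N}\cup\{\infty\}$, $\nu_{F,M_0}(i):=\min\{j\in\mathbb{N}\cup\{\infty\} \mid A_jM_{i,gen}\supseteq M_0 \text{ for all } M_{i,gen}\}$, where $M_{i,gen}$ runs through all subspaces of $M_i$ that generate $M$ as an $A$-module. The filter dimension of $M$ is $\operatorname{fdim}(M):=\gamma(\nu_{F,M_0})$; it does not depend on the choice of $F$ and $M_0$.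 The filter dimension of the algebra $A$ is $\operatorname{fdim}(A):=\operatorname{fdim}({}_AA_A)$, where the bimodule ${}_AA_A$ is regarded as a left module over $A\otimes_K A^{op}$. When $A$ is simple and finitely generated, $\operatorname{fdim}(A)=\gamma(\nu_F)$ where $\nu_F(i):=\min\{j\in\mathbb{N}\cup\{\infty\}\mid 1\in A_jaA_j \text{ for all } 0\ne a\in A_i\}$, and $A_jaA_j$ is the $K$-span of all $xay$ with $x,y\in A_j$. Morita equivalence: $K$-algebras $A$ and $B$ are Morita equivalent iff there is a Morita context $\begin{pmatrix} A & X\\ Y & B\end{pmatrix}$ of $K$-algebras with bimodules ${}_AX_B$, ${}_BY_A$ such that $XY=A$ and $YX=B$. *)

(* Defs.v *)
From HB Require Import structures.
From mathcomp Require Import all_boot all_order all_algebra.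
From mathcomp Require Import all_classical all_reals all_analysis.

Set Implicit Arguments.
Unset Strict Implicit.
Unset Printing Implicit Defensive.

Import Order.TTheory GRing.Theory Num.Theory.

Local Open Scope classical_set_scope.
Local Open Scope ring_scope.

Definition lspan (R : pzRingType) (V : lmodType R) (X : set V) : set V :=
  smallest [set W : set V | GRing.submod_closed (mem W)] X.

Lemma dual_vector (K : fieldType) (V : lmodType K) (v : V) :
  v != 0 -> exists2 f : V -> K^o, linear f & f v = 1.
Proof.
move=> v0.
pose P (W : set V) :=
  ~ W v /\ forall a u w, W u -> W w -> W (a *: u + w).
have [F FP Ftot|W [[Wv Wlin] Wmax]] := @Zorn_bigcup V P.
  split=> [[W FW Wv]|a u w [W1 F1 W1u] [W2 F2 W2w]]; first by case: (FP _ FW).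
  have [s12|s21] := Ftot _ _ F1 F2.
    by exists W2 => //; apply: (FP _ F2).2 => //; exact: s12.
  by exists W1 => //; apply: (FP _ F1).2 => //; exact: s21.
have W0 : W 0.
  apply: contrapT => nW0.
  have WE : W = set0.
    apply/seteqP; split=> // w Ww; apply: nW0.
    by have := Wlin (-1) w w Ww Ww; rewrite scaleN1r addNr.
  apply: (Wmax [set 0]).
    by rewrite WE; split=> // /(_ 0); apply.
  split=> [/= /eqP|a u w /= -> ->]; first by apply/negP.
  by rewrite scaler0 addr0.
have dec x : exists c, W (x - c *: v).
  have [Wx|nWx] := pselect (W x); first by exists 0; rewrite scale0r subr0.
  pose W' := [set y | exists2 a, W (y - a *: x) & True].
  have [c Wc] : exists c, W (v - c *: x).
    apply: contrapT => nv; apply: (Wmax W').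
      split=> [w Ww|sub]; first by exists 0 => //; rewrite scale0r subr0.
      by apply: nWx; apply: sub; exists 1 => //; rewrite scale1r subrr.
    split=> [[c Wc _]|a u w [c Wc _] [d Wd _]]; first by apply: nv; exists c.
    exists (a * c + d) => //; have := Wlin a _ _ Wc Wd.
    by rewrite scalerBr scalerA addrACA -opprD scalerDl.
  have c0 : c != 0.
    by apply/eqP => cz; apply: Wv; move: Wc; rewrite cz scale0r subr0.
  exists c^-1; have := Wlin (- c^-1) _ _ Wc W0.
  by rewrite addr0 scalerBr scalerA mulNr mulVf // !scaleNr scale1r opprK addrC.
pose f x : K^o := sval (cid (dec x)).
have fW x : W (x - f x *: v) by rewrite /f; case: cid.
have funiq x c : W (x - c *: v) -> f x = c.
  move=> Wc; apply/eqP; rewrite -subr_eq0; apply/negP => /negP d0; apply: Wv.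
  have := Wlin (-1) _ _ (fW x) Wc.
  rewrite scaleN1r opprB addrA subrK -scalerBl => Wd.
  have := Wlin (f x - c)^-1 _ _ Wd W0.
  by rewrite addr0 scalerA mulVf // scale1r.
exists f; last by apply: funiq; rewrite scale1r subrr.
move=> a x y; apply: funiq.
have := Wlin a _ _ (fW x) (fW y).
by rewrite scalerBr scalerA addrACA -opprD -scalerDl.
Qed.


Section Tensor.
Variables (K : fieldType) (A B : algType K).
Local Open Scope quotient_scope.

(* A list of pairs (a_k, b_k) stands for the sum of the a_k (x) b_k; two such
   sums are equal in A (x) B iff no bilinear map tells them apart. *)
Definition tens_eqv (s t : seq (A * B)) : bool :=
  `[< forall (V : lmodType K) (f : A -> B -> V), bilinear_for *:%R *:%R f ->
      \sum_(p <- s) f p.1 p.2 = \sum_(p <- t) f p.1 p.2 >].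

Lemma tens_eqv_refl : reflexive tens_eqv.
Proof. by move=> s; apply/asboolP. Qed.

Lemma tens_eqv_sym : symmetric tens_eqv.
Proof. by move=> s t; apply/asboolP/asboolP => h V f bf; rewrite (h V f bf). Qed.

Lemma tens_eqv_trans : transitive tens_eqv.
Proof.
move=> t s u /asboolP h1 /asboolP h2; apply/asboolP => V f bf.
by rewrite (h1 V f bf) (h2 V f bf).
Qed.

Canonical tens_equiv :=
  EquivRel tens_eqv tens_eqv_refl tens_eqv_sym tens_eqv_trans.

Definition tensor : Type := {eq_quot tens_eqv}.
HB.instance Definition _ := Choice.on tensor.
HB.instance Definition _ := EqQuotient.on tensor.

Definition tens_of_seq (s : seq (A * B)) : tensor := \pi_tensor s.
Definition pure_tensor (a : A) (b : B) : tensor := tens_of_seq [:: (a, b)].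

Definition tens_lift (V : lmodType K) (f : A -> B -> V) (t : tensor) : V :=
  \sum_(p <- repr t) f p.1 p.2.

Lemma tens_liftE (V : lmodType K) (f : A -> B -> V) s :
  bilinear_for *:%R *:%R f ->
  tens_lift f (tens_of_seq s) = \sum_(p <- s) f p.1 p.2.
Proof.
move=> bf; have /eqmodP/asboolP : repr (tens_of_seq s) = s %[mod tensor].
  by rewrite reprK.
exact.
Qed.

Lemma tens_ext (t u : tensor) :
  (forall (V : lmodType K) (f : A -> B -> V), bilinear_for *:%R *:%R f ->
     tens_lift f t = tens_lift f u) -> t = u.
Proof.
by move=> h; rewrite -[t]reprK -[u]reprK; apply/eqmodP/asboolP => V f /h.
Qed.

Definition tens_add (t u : tensor) := tens_of_seq (repr t ++ repr u).
Definition tens_zero := tens_of_seq [::].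
Definition tens_scale (k : K) (t : tensor) :=
  tens_of_seq [seq (k *: p.1, p.2) | p <- repr t].
Definition tens_opp := tens_scale (-1).
Definition tens_one := pure_tensor 1 1.
Definition tens_mul (t u : tensor) :=
  tens_of_seq [seq (p.1 * q.1, p.2 * q.2) | p <- repr t, q <- repr u].

Section Lift.
Variables (V : lmodType K) (f : A -> B -> V).
Hypothesis bf : bilinear_for *:%R *:%R f.

Lemma tens_lift_add t u :
  tens_lift f (tens_add t u) = tens_lift f t + tens_lift f u.
Proof. by rewrite tens_liftE // big_cat. Qed.

Lemma tens_lift_zero : tens_lift f tens_zero = 0.
Proof. by rewrite tens_liftE // big_nil. Qed.

Lemma bilin_scalel k a b : f (k *: a) b = k *: f a b.
Proof.
have h0 : f 0 b = 0 by have /= := bf.1 b (-1) a a; rewrite !scaleN1r !addNr.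
by have /= := bf.1 b k a 0; rewrite h0 !addr0.
Qed.

Lemma bilin_scaler k a b : f a (k *: b) = k *: f a b.
Proof.
have h0 : f a 0 = 0 by have /= := bf.2 a (-1) b b; rewrite !scaleN1r !addNr.
by have /= := bf.2 a k b 0; rewrite h0 !addr0.
Qed.

Lemma bilin_addl a a' b : f (a + a') b = f a b + f a' b.
Proof. by have /= := bf.1 b 1 a a'; rewrite !scale1r. Qed.

Lemma bilin_addr a b b' : f a (b + b') = f a b + f a b'.
Proof. by have /= := bf.2 a 1 b b'; rewrite !scale1r. Qed.

Lemma tens_lift_scale k t : tens_lift f (tens_scale k t) = k *: tens_lift f t.
Proof.
rewrite tens_liftE // big_map scaler_sumr.
by apply: eq_bigr => p _ /=; rewrite bilin_scalel.
Qed.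

Lemma tens_lift_pure a b : tens_lift f (pure_tensor a b) = f a b.
Proof. by rewrite tens_liftE // big_seq1. Qed.

Lemma bilin_mulr a b :
  bilinear_for *:%R *:%R (fun a' b' => f (a * a') (b * b')).
Proof.
split=> [b'|a'] k x y /=.
  by rewrite mulrDr bilin_addl -scalerAr bilin_scalel.
by rewrite mulrDr bilin_addr -scalerAr bilin_scaler.
Qed.

Lemma bilin_mull (u : tensor) :
  bilinear_for *:%R *:%R
    (fun a b => tens_lift (fun a' b' => f (a * a') (b * b')) u).
Proof.
split=> [b|a] k x y; rewrite /tens_lift /= scaler_sumr -big_split /=;
  apply: eq_bigr => p _ /=.
  by rewrite mulrDl bilin_addl -scalerAl bilin_scalel.
by rewrite mulrDl bilin_addr -scalerAl bilin_scaler.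
Qed.

Lemma tens_lift_mul t u :
  tens_lift f (tens_mul t u) =
  tens_lift (fun a b => tens_lift (fun a' b' => f (a * a') (b * b')) u) t.
Proof. by rewrite tens_liftE // big_allpairs_dep. Qed.

Lemma tens_lift_ext (g : A -> B -> V) (t : tensor) :
  (forall a b, f a b = g a b) -> tens_lift f t = tens_lift g t.
Proof. by move=> fg; apply: eq_bigr => p _. Qed.

End Lift.

Let tens_addA : associative tens_add.
Proof. by move=> t u v; apply: tens_ext => V f bf; rewrite !(tens_lift_add bf) addrA. Qed.

Let tens_addC : commutative tens_add.
Proof. by move=> t u; apply: tens_ext => V f bf; rewrite !(tens_lift_add bf) addrC. Qed.

Let tens_add0 : left_id tens_zero tens_add.
Proof.
by move=> t; apply: tens_ext => V f bf; rewrite (tens_lift_add bf) (tens_lift_zero bf) add0r.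
Qed.

Let tens_addN : left_inverse tens_zero tens_opp tens_add.
Proof.
move=> t; apply: tens_ext => V f bf.
by rewrite (tens_lift_add bf) (tens_lift_scale bf) (tens_lift_zero bf) scaleN1r addNr.
Qed.

HB.instance Definition _ :=
  GRing.isZmodule.Build tensor tens_addA tens_addC tens_add0 tens_addN.

Let tens_scaleA a b t : tens_scale a (tens_scale b t) = tens_scale (a * b) t.
Proof.
by apply: tens_ext => V f bf; rewrite !(tens_lift_scale bf) scalerA.
Qed.

Let tens_scale1 : left_id 1 tens_scale.
Proof.
by move=> t; apply: tens_ext => V f bf; rewrite (tens_lift_scale bf) scale1r.
Qed.

Let tens_scaleDr : right_distributive tens_scale +%R.
Proof.
move=> k t u; apply: tens_ext => V f bf.
by rewrite (tens_lift_scale bf) !(tens_lift_add bf) !(tens_lift_scale bf) scalerDr.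
Qed.

Let tens_scaleDl t : {morph tens_scale^~ t : a b / a + b}.
Proof.
move=> a b; apply: tens_ext => V f bf.
by rewrite (tens_lift_add bf) !(tens_lift_scale bf) scalerDl.
Qed.

HB.instance Definition _ := GRing.Zmodule_isLmodule.Build K tensor
  tens_scaleA tens_scale1 tens_scaleDr tens_scaleDl.

Let tens_mulA : associative tens_mul.
Proof.
move=> t u v; apply: tens_ext => V f bf.
rewrite !(tens_lift_mul bf) (tens_lift_mul (bilin_mull bf v)).
apply: tens_lift_ext => a b; rewrite (tens_lift_mul (bilin_mulr bf a b)).
apply: tens_lift_ext => a' b'; apply: tens_lift_ext => a'' b''.
by rewrite !mulrA.
Qed.

Let tens_mul1l : left_id tens_one tens_mul.
Proof.
move=> t; apply: tens_ext => V f bf.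
rewrite (tens_lift_mul bf) (tens_lift_pure (bilin_mull bf t)).
by apply: tens_lift_ext => a b; rewrite !mul1r.
Qed.

Let tens_mul1r : right_id tens_one tens_mul.
Proof.
move=> t; apply: tens_ext => V f bf; rewrite (tens_lift_mul bf).
apply: tens_lift_ext => a b; rewrite (tens_lift_pure (bilin_mulr bf a b)).
by rewrite !mulr1.
Qed.

Let tens_mulDl : left_distributive tens_mul +%R.
Proof.
move=> t u v; apply: tens_ext => V f bf.
rewrite (tens_lift_add bf) !(tens_lift_mul bf).
exact: (tens_lift_add (bilin_mull bf v)).
Qed.

Let tens_mulDr : right_distributive tens_mul +%R.
Proof.
move=> t u v; apply: tens_ext => V f bf.
rewrite (tens_lift_add bf) !(tens_lift_mul bf) [in RHS]/tens_lift -big_split /=.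
apply: eq_bigr => p _; exact: (tens_lift_add (bilin_mulr bf _ _)).
Qed.

Let tens_one_neq0 : tens_one != 0.
Proof.
have [f fl f1] := dual_vector (oner_neq0 A).
have [g gl g1] := dual_vector (oner_neq0 B).
pose h (a : A) (b : B) : K^o := f a * g b.
have bh : bilinear_for *:%R *:%R h.
  split=> [b|a] k x y; rewrite /h /=.
    by rewrite fl mulrDl -mulrA.
  by rewrite gl mulrDr; congr (_ + _); rewrite mulrCA.
apply/eqP => /(congr1 (tens_lift h)).
rewrite (tens_lift_pure bh) (tens_lift_zero bh) /h f1 g1 mulr1 => /eqP.
exact/negP/oner_neq0.
Qed.

HB.instance Definition _ := GRing.Zmodule_isNzRing.Build tensor
  tens_mulA tens_mul1l tens_mul1r tens_mulDl tens_mulDr tens_one_neq0.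

Let tens_scaleAl (k : K) (t u : tensor) : k *: (t * u) = k *: t * u.
Proof.
apply: tens_ext => V f bf.
rewrite (tens_lift_scale bf) !(tens_lift_mul bf).
exact: (esym (tens_lift_scale (bilin_mull bf u) _ _)).
Qed.

HB.instance Definition _ :=
  GRing.Lmodule_isLalgebra.Build K tensor tens_scaleAl.

Let tens_scaleAr (k : K) (t u : tensor) : k *: (t * u) = t * (k *: u).
Proof.
apply: tens_ext => V f bf.
rewrite (tens_lift_scale bf) !(tens_lift_mul bf) {1}/tens_lift scaler_sumr.
apply: eq_bigr => p _; exact: (esym (tens_lift_scale (bilin_mulr bf _ _) _ _)).
Qed.

HB.instance Definition _ :=
  GRing.Lalgebra_isAlgebra.Build K tensor tens_scaleAr.

Lemma tens_lift_linear (V : lmodType K) (f : A -> B -> V) :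
  bilinear_for *:%R *:%R f -> linear (tens_lift f).
Proof.
move=> bf k t u.
by rewrite [LHS](tens_lift_add bf) [X in X + _](tens_lift_scale bf).
Qed.

Lemma pure_tensor_bilinear : bilinear_for *:%R *:%R pure_tensor.
Proof.
split=> [b|a] k x y; apply: tens_ext => V f bf;
  rewrite (tens_lift_linear bf) !(tens_lift_pure bf).
  exact: bf.1.
exact: bf.2.
Qed.

Lemma pure_tensorM a a' b b' :
  pure_tensor a b * pure_tensor a' b' = pure_tensor (a * a') (b * b').
Proof.
apply: tens_ext => V f bf; rewrite [LHS](tens_lift_mul bf).
rewrite (tens_lift_pure (bilin_mull bf _)) (tens_lift_pure (bilin_mulr bf _ _)).
by rewrite (tens_lift_pure bf).
Qed.

Lemma tensor_sum_pure (t : tensor) :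
  t = \sum_(p <- repr t) pure_tensor p.1 p.2.
Proof.
apply: tens_ext => V f bf.
have H (s : seq (A * B)) : tens_lift f (\sum_(p <- s) pure_tensor p.1 p.2) =
    \sum_(p <- s) f p.1 p.2.
  elim: s => [|p s IH]; first by rewrite !big_nil; exact: (tens_lift_zero bf).
  by rewrite !big_cons [LHS](tens_lift_add bf) IH (tens_lift_pure bf).
by rewrite H.
Qed.

End Tensor.

Arguments pure_tensor {K A B}.


Section Opposite.
Variables (K : fieldType) (A : algType K).

HB.instance Definition _ := GRing.Zmodule_isLmodule.Build K A^c
  (@scalerA K A) (@scale1r K A) (@scalerDr K A) (@scalerDl K A).

Let conv_scaleAl (k : K) (x y : A^c) : k *: (x * y) = k *: x * y.
Proof. exact: (@scalerAr K A k y x). Qed.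

HB.instance Definition _ := GRing.Lmodule_isLalgebra.Build K A^c conv_scaleAl.

Let conv_scaleAr (k : K) (x y : A^c) : k *: (x * y) = x * (k *: y).
Proof. exact: (@scalerAl K A k y x). Qed.

HB.instance Definition _ := GRing.Lalgebra_isAlgebra.Build K A^c conv_scaleAr.

End Opposite.

(* The K-algebra whose left modules are the A-B-bimodules on which K acts
   centrally. *)
Notation bimod_alg A B := (tensor A B^c).

Definition lact (K : fieldType) (A B : algType K) (X : lmodType (bimod_alg A B))
  (a : A) (x : X) : X := (pure_tensor a (1 : B^c)) *: x.

Definition ract (K : fieldType) (A B : algType K) (X : lmodType (bimod_alg A B))
  (x : X) (b : B) : X := (pure_tensor (1 : A) (b : B^c)) *: x.

Section RegularBimodule.
Variables (K : fieldType) (A : algType K).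

Definition regular_bimodule : Type := A.
HB.instance Definition _ := GRing.Zmodule.on regular_bimodule.

(* (a (x) b) . x = a x b *)
Definition bimul (t : bimod_alg A A) (x : regular_bimodule) : regular_bimodule :=
  tens_lift (fun (a : A) (b : A^c) => a * (x : A) * (b : A)) t.

Let bilin_bimul (x : A) :
  bilinear_for *:%R *:%R (fun (a : A) (b : A^c) => a * x * (b : A)).
Proof.
split=> [b|a] k y z /=.
  by rewrite !mulrDl -!scalerAl.
by rewrite mulrDr; congr (_ + _); exact: (esym (scalerAr _ _ _)).
Qed.

Lemma bimulE a (b : A^c) x : bimul (pure_tensor a b) x = a * x * (b : A).
Proof. exact: tens_lift_pure. Qed.

Let bimulA t u x : bimul t (bimul u x) = bimul (t * u) x.
Proof.
rewrite /bimul [RHS](tens_lift_mul (bilin_bimul x)).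
apply: eq_bigr => p _; rewrite /tens_lift mulr_sumr mulr_suml.
by apply: eq_bigr => q _; rewrite !mulrA.
Qed.

Let bimul1 : left_id 1 bimul.
Proof. by move=> x; rewrite bimulE mul1r mulr1. Qed.

Let bimulDr : right_distributive bimul +%R.
Proof.
move=> t x y; rewrite /bimul /tens_lift -big_split /=.
by apply: eq_bigr => p _; rewrite mulrDr mulrDl.
Qed.

Let bimulDl x : {morph bimul^~ x : t u / t + u}.
Proof. by move=> t u; exact: (tens_lift_add (bilin_bimul x)). Qed.

HB.instance Definition _ := GRing.Zmodule_isLmodule.Build (bimod_alg A A)
  regular_bimodule bimulA bimul1 bimulDr bimulDl.

End RegularBimodule.


Definition Morita_context (K : fieldType) (A B : algType K)
    (X : lmodType (bimod_alg A B)) (Y : lmodType (bimod_alg B A))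
    (xy : X -> Y -> A) (yx : Y -> X -> B) : Prop :=
  [/\ [/\ forall x x' y, xy (x + x') y = xy x y + xy x' y,
          forall x y y', xy x (y + y') = xy x y + xy x y',
          forall a x y, xy (lact a x) y = a * xy x y,
          forall x y a, xy x (ract y a) = xy x y * a
        & forall x b y, xy (ract x b) y = xy x (lact b y)],
      [/\ forall y y' x, yx (y + y') x = yx y x + yx y' x,
          forall y x x', yx y (x + x') = yx y x + yx y x',
          forall b y x, yx (lact b y) x = b * yx y x,
          forall y x b, yx y (ract x b) = yx y x * b
        & forall y a x, yx (ract y a) x = yx y (lact a x)],
      forall x y x', lact (xy x y) x' = ract x (yx y x')
    & forall y x y', lact (yx y x) y' = ract y (xy x y')].

Definition Morita_equivalent (K : fieldType) (A B : algType K) : Prop :=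
  exists (X : lmodType (bimod_alg A B)) (Y : lmodType (bimod_alg B A))
         (xy : X -> Y -> A) (yx : Y -> X -> B),
  [/\ Morita_context xy yx,
      lspan [set xy x y | x in [set: X] & y in [set: Y]] = [set: A]
    & lspan [set yx y x | y in [set: Y] & x in [set: X]] = [set: B]].


Definition simple_algebra (K : fieldType) (A : algType K) : Prop :=
  forall I : set A, GRing.zmod_closed (mem I) ->
    (forall a x, I x -> I (a * x) /\ I (x * a)) ->
    I = [set 0] \/ I = [set: A].

Definition generates_algebra (K : fieldType) (A : algType K) (s : seq A) : Prop :=
  smallest [set S : set A | GRing.subalg_closed (mem S)] [set` s] = [set: A].

Definition fg_algebra (K : fieldType) (A : algType K) : Prop :=
  exists s : seq A, generates_algebra s.

(* For i = 0 the only product is the empty one, so A_0 = K. *)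
Definition std_filtration (K : fieldType) (A : algType K) (s : seq A) (i : nat) :
    set A :=
  let A1 := lspan (1 |` [set` s]) in
  lspan [set \prod_(j < i) u j | u in [set u : 'I_i -> A | forall j, A1 (u j)]].

(* An A-module viewed as a K-vector space. *)
Definition restrict_scalars (K : fieldType) (A : algType K) (M : lmodType A) :
  Type := M.

Section RestrictScalars.
Variables (K : fieldType) (A : algType K) (M : lmodType A).
Local Notation MK := (restrict_scalars M).

HB.instance Definition _ := GRing.Zmodule.on MK.

Let rscale (k : K) (m : MK) : MK := (k%:A : A) *: (m : M).

Let rscaleA a b m : rscale a (rscale b m) = rscale (a * b) m.
Proof. by rewrite /rscale scalerA mulr_algl scalerA. Qed.

Let rscale1 : left_id 1 rscale.
Proof. by move=> m; rewrite /rscale !scale1r. Qed.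

Let rscaleDr : right_distributive rscale +%R.
Proof. by move=> k m n; exact: scalerDr. Qed.

Let rscaleDl m : {morph rscale^~ m : a b / a + b}.
Proof. by move=> a b; rewrite /rscale !scalerDl. Qed.

HB.instance Definition _ := GRing.Zmodule_isLmodule.Build K MK
  rscaleA rscale1 rscaleDr rscaleDl.

End RestrictScalars.

Definition degree (R : realType) (f : nat -> \bar R) : \bar R :=
  ereal_inf [set r%:E | r in
    [set r : R | 0 <= r /\ \forall i \near \oo, (f i <= (i%:R `^ r)%:E)%E]].

Section FilterDimension.
Variables (R : realType) (K : fieldType) (A : algType K) (M : lmodType A).
Local Notation MK := (restrict_scalars M).

Definition act_span (S : set A) (N : set MK) : set MK :=
  lspan [set (a *: (m : M) : MK) | a in S & m in N].

Definition fin_dim (N : set MK) : Prop :=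
  exists s : seq MK, N = lspan [set` s].

Definition generates_module (N : set MK) : Prop :=
  lspan (N : set M) = [set: M].

(* Least j such that the inclusion holds for all N; [ereal_inf] of the empty
   set is +oo. *)
Definition return_function (F : nat -> set A) (M0 : set MK) (i : nat) : \bar R :=
  ereal_inf [set j%:R%:E | j in [set j : nat |
    forall N : set MK, GRing.submod_closed (mem N) ->
      N `<=` act_span (F i) M0 -> generates_module N ->
      M0 `<=` act_span (F j) N]].

Definition fdim_values : set (\bar R) :=
  [set d | exists (s : seq A) (M0 : set MK),
    [/\ generates_algebra s, fin_dim M0, generates_module M0
      & d = degree (return_function (std_filtration s) M0)]].

(* For finitely generated A and M, [fdim_values] is a singleton: the degree
   depends neither on the generators nor on M0. *)
Definition fdim_module : \bar R := xget +oo%E fdim_values.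

End FilterDimension.

Definition fdim (R : realType) (K : fieldType) (A : algType K) : \bar R :=
  @fdim_module R K (bimod_alg A A) (regular_bimodule A).

(* Main.v *)
(* Choose finite families x_i in X, y_i in Y such that partial sums of the
   x_i y_i and of the y_i x_i give 1_A and 1_B.  The maps a |-> y_i a x_j and
   b |-> x_i b y_j turn the action of A (x) A^op on A into that of B (x) B^op on
   B and conversely: inserting 1_A = sum_u x_u y_u gives
     y_i (p a q) x_j = sum_(u,v) (y_i p x_u) (y_u a x_v) (y_v q x_j),
   so filtration degrees grow at most linearly under these maps.  If a <> 0 then
   some y_i a x_j <> 0, and by simplicity of B it generates B; pulling the
   resulting inclusion back to A yields nu_A(i) <= c nu_B(a i + b) + d, whence
   fdim A <= fdim B, and the converse by symmetry.  The same inequality shows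
   that the choice of generators is irrelevant. *)

Require Import Defs.
From mathcomp Require Import all_boot all_order all_algebra.
From mathcomp Require Import all_classical all_reals all_analysis.

Set Implicit Arguments.
Unset Strict Implicit.
Unset Printing Implicit Defensive.
Import Order.TTheory GRing.Theory Num.Theory.
Local Open Scope classical_set_scope.
Local Open Scope ring_scope.

(** * Degrees under affine changes of argument and value *)

(** The hypothesis bounds the first function at i by c times the second at a*i+b, plus d. Under a
    bound i^r on the second this costs only a constant factor, which i^e absorbs for every e > 0;
    positivity of a makes a*i+b tend to infinity. *)
Lemma degree_inf_le (R : realType) (S T : nat -> set nat) (a b c d : nat) :
  (0 < a)%N -> (forall i j, T (a * i + b)%N j -> S i (c * j + d)%N) ->
  (degree (fun i => ereal_inf [set (j%:R%:E : \bar R) | j in S i]) <=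
   degree (fun i => ereal_inf [set (j%:R%:E : \bar R) | j in T i]))%E.
Proof.
move=> a0 TS; apply: le_ereal_inf_tmp => _ [r [r0 Tr] <-].
apply/lee_addgt0Pr => e e0; apply: ereal_inf_lbound; exists (r + e) => //.
split; first by rewrite addr_ge0 // ltW.
pose C : R := c%:R * ((a + b)%:R `^ r + 1) + d%:R.
case: Tr => N _ TN.
have C0 : 0 <= C by rewrite addr_ge0 // mulr_ge0 // addr_ge0 // powR_ge0.
near=> i.
have i1 : 1 <= i%:R :> R by rewrite ler1n; near: i; exists 1%N.
have ile : (N <= (a * i + b))%N.
  rewrite (leq_trans _ (leq_addr _ _)) // (leq_trans _ (leq_pmull _ a0)) //.
  by near: i; exists N.
have ir1 : 1 <= i%:R `^ r :> R.
  have {1}-> : 1 = 1 `^ r :> R by rewrite powR1.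
  by rewrite ge0_ler_powR // nnegrE.
(* The strict excess 1 yields an actual j in [T (a * i + b)] without knowing that the infimum is
   attained. *)
have : (ereal_inf [set (j%:R%:E : \bar R) | j in T (a * i + b)%N] <
    ((a * i + b)%:R `^ r + 1)%:E)%E.
  by apply: le_lt_trans (TN _ ile) _; rewrite lte_fin ltrDl.
move=> /ereal_inf_lt[_ [j Tj <-]]; rewrite lte_fin => jlt.
apply: le_trans (ereal_inf_lbound _) _;
  first by exists (c * j + d)%N; [exact: TS|reflexivity].
rewrite lee_fin.
have ab : (a * i + b)%:R `^ r <= (a + b)%:R `^ r * i%:R `^ r :> R.
  rewrite -powRM // -natrM ge0_ler_powR ?nnegrE // ler_nat mulnDl leq_add2l.
  by rewrite leq_pmulr // -(@ler1n R).
have -> : i%:R `^ (r + e) = i%:R `^ e * i%:R `^ r :> R.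
  rewrite addrC powRD //; apply/implyP => _.
  by rewrite gt_eqF // (lt_le_trans ltr01).
apply: (@le_trans _ _ (C * i%:R `^ r)).
  rewrite natrD natrM /C mulrDl lerD //; last by rewrite ler_peMr.
  rewrite -mulrA ler_wpM2l // (le_trans (ltW jlt)) // mulrDl lerD //.
  by rewrite mul1r.
rewrite ler_wpM2r ?powR_ge0 //.
(* The factor i^e dominates C as soon as i passes C^(1/e). *)
have -> : C = (C `^ e^-1) `^ e by rewrite -powRrM mulVf ?powRr1 // gt_eqF.
rewrite ge0_ler_powR ?nnegrE ?powR_ge0 //; first exact: ltW.
near: i; exact: nbhs_infty_ger.
Unshelve. all: by end_near. Qed.

(** * Linear spans *)

Lemma submod_closedP (R : pzRingType) (V : lmodType R) (W : set V) :
  GRing.submod_closed (mem W) <->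
  W 0 /\ forall a u v, W u -> W v -> W (a *: u + v).
Proof.
split=> [[]|[W0 Wl]].
  rewrite inE => W0 Wl; split=> // a u v Wu Wv.
  by have := Wl a u v; rewrite !inE; apply.
by split=> [|a u v]; rewrite !inE //; exact: Wl.
Qed.

Section LinearSpan.
Variables (R : pzRingType) (V : lmodType R).
Implicit Types X W : set V.

Lemma lspan_submod X : GRing.submod_closed (mem (lspan X)).
Proof.
apply/submod_closedP; split=> [W [/submod_closedP[]]//|a u v Xu Xv W].
by move=> [/[dup] Wc /submod_closedP[_ Wl] XW];
  apply: Wl; [apply: Xu|apply: Xv].
Qed.

Lemma sub_lspan X : X `<=` lspan X.
Proof. by move=> x Xx W [_]; apply. Qed.

Lemma lspan_min X W : GRing.submod_closed (mem W) -> X `<=` W -> lspan X `<=` W.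
Proof. by move=> Wc XW x; apply. Qed.

Lemma lspan_le X W : X `<=` W -> lspan X `<=` lspan W.
Proof.
move=> XW; apply: lspan_min (lspan_submod W) _; apply: subset_trans XW (@sub_lspan _).
Qed.

Lemma lspan0 X : lspan X 0.
Proof. by have /submod_closedP[] := lspan_submod X. Qed.

Lemma lspanZD X a u v : lspan X u -> lspan X v -> lspan X (a *: u + v).
Proof. by have /submod_closedP[_] := lspan_submod X; apply. Qed.

Lemma lspanD X u v : lspan X u -> lspan X v -> lspan X (u + v).
Proof. by move=> Xu Xv; rewrite -[u]scale1r; exact: lspanZD. Qed.

Lemma lspanZ X a u : lspan X u -> lspan X (a *: u).
Proof.
by move=> Xu; rewrite -[_ *: _]addr0; apply: lspanZD => //; exact: lspan0.
Qed.

Lemma lspan_sum X (I : Type) (r : seq I) (P : pred I) (F : I -> V) :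
  (forall i, P i -> lspan X (F i)) -> lspan X (\sum_(i <- r | P i) F i).
Proof. by move=> XF; elim/big_ind: _ => //; [exact: lspan0|exact: lspanD]. Qed.

End LinearSpan.

(** * Standard filtrations and their action on modules *)

Section StandardFiltration.
Variables (K : fieldType) (A : algType K) (s : seq A).
Local Notation F := (std_filtration s).
Local Notation A1 := (lspan (1 |` [set` s])).

Lemma filtration_prod i (u : 'I_i -> A) :
  (forall j, A1 (u j)) -> F i (\prod_(j < i) u j).
Proof. by move=> A1u; apply: sub_lspan; exists u. Qed.

Lemma filtration_monoid i j a b : F i a -> F j b -> F (i + j) (a * b).
Proof.
move=> Fa Fb; move: a Fa; apply: lspan_min.
  apply/submod_closedP; split=> [|k x y Fx Fy];
    first by rewrite /= mul0r; exact: lspan0.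
  by rewrite /= mulrDl -scalerAl; exact: lspanZD.
move=> _ [u A1u <-]; move: b Fb; apply: lspan_min.
  apply/submod_closedP; split=> [|k x y Fx Fy];
    first by rewrite /= mulr0; exact: lspan0.
  by rewrite /= mulrDr -scalerAr; exact: lspanZD.
move=> _ [v A1v <-] /=.
pose w k := match fintype.split k with inl k => u k | inr k => v k end.
have -> : \prod_(k < i) u k * \prod_(k < j) v k = \prod_(k < i + j) w k.
  rewrite big_split_ord /=; congr (_ * _); apply: eq_bigr => k _; rewrite /w.
    by case: split_ordP => k' /eqP;
      rewrite ?eq_lshift ?eq_lrshift // => /eqP ->.
  by case: split_ordP => k' /eqP; rewrite ?eq_rshift ?eq_rlshift // => /eqP ->.
apply: filtration_prod => k; rewrite /w;
  case: fintype.split => k'; [exact: A1u|exact: A1v].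
Qed.

Lemma filtration_one i : F i 1.
Proof.
have -> : 1 = \prod_(j < i) (1 : A) by rewrite big1.
by apply: filtration_prod => _; apply: sub_lspan; left.
Qed.

Lemma filtration_mono i j : (i <= j)%N -> F i `<=` F j.
Proof.
move=> /subnKC <- a Fa; rewrite -[a]mulr1.
by apply: filtration_monoid => //; exact: filtration_one.
Qed.

Lemma filtration1 : A1 `<=` F 1.
Proof.
by move=> a A1a; have := @filtration_prod 1 (fun=> a); rewrite big_ord1; apply.
Qed.

(** The union of the filtration is a subalgebra containing the generators. *)
Lemma filtration_exhaust a : generates_algebra s -> exists i, F i a.
Proof.
move=> gens; have : [set: A] a by []; rewrite -gens; move: a.
apply: (@smallest_sub _ _ _ [set a | exists i, F i a]); last first.
  by move=> a sa; exists 1; apply: filtration1; apply: sub_lspan; right.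
split=> [|k a b|a b]; rewrite !inE.
- by exists 0; exact: filtration_one.
- move=> [i Fa] [j Fb]; exists (maxn i j).
  apply: lspanZD; [exact: filtration_mono (leq_maxl _ _) _ Fa|].
  exact: filtration_mono (leq_maxr _ _) _ Fb.
- by move=> [i Fa] [j Fb]; exists (i + j)%N; exact: filtration_monoid.
Qed.

End StandardFiltration.

Section ActSpan.
Variables (K : fieldType) (A : algType K) (M : lmodType A).
Local Notation MK := (restrict_scalars M).
Local Notation act a m := ((a : A) *: ((m : MK) : M) : MK).
Implicit Types (S T : set A) (N P : set MK).

Lemma act_span_mem S N a m : S a -> N m -> act_span S N (act a m).
Proof. by move=> Sa Nm; apply: sub_lspan; exists a => //; exists m. Qed.

Lemma act_span_mono S T N P : S `<=` T -> N `<=` P ->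
  act_span S N `<=` act_span T P.
Proof.
by move=> ST NP; apply: lspan_le => _ [a Sa [m Nm <-]];
  exists a; [exact: ST|exists m => //; exact: NP].
Qed.

Lemma act_span_min S N P : GRing.submod_closed (mem P) ->
  (forall a m, S a -> N m -> P (act a m)) -> act_span S N `<=` P.
Proof.
by move=> Pc SNP; apply: lspan_min => // _ [a Sa [m Nm <-]]; exact: SNP.
Qed.

(** K acts through the elements [k%:A], which are central in [A]. *)
Lemma act_linear (a : A) (k : K) (m n : MK) :
  act a (k *: m + n) = k *: (act a m) + act a n.
Proof.
have -> : act a (k *: m + n) = act a ((k%:A : A) *: (m : M)) + act a n
  by exact: (@scalerDr A M).
congr (_ + _); rewrite scalerA mulr_algr -mulr_algl -scalerA; reflexivity.
Qed.

Lemma act_linearl (k : K) (a b : A) (m : MK) :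
  act (k *: a + b) m = k *: (act a m) + act b m.
Proof.
have -> : act (k *: a + b) m = act (k *: a) m + act b m
  by exact: (@scalerDl A M).
by congr (_ + _); rewrite -mulr_algl -scalerA.
Qed.

Lemma act_span_act S T N a m : (forall b, T b -> S (a * b)) ->
  act_span T N m -> act_span S N (act a m).
Proof.
move=> aTS; move: m; apply: act_span_min.
  apply/submod_closedP; split=> [|k u v Nu Nv] /=;
    first by rewrite scaler0; exact: lspan0.
  by rewrite act_linear; exact: lspanZD.
by move=> b m Tb Nm /=; rewrite scalerA; apply: act_span_mem => //; exact: aTS.
Qed.

Lemma act_span_lspan S N : act_span S (lspan N) `<=` act_span S N.
Proof.
apply: act_span_min => [|a m Sa]; first exact: lspan_submod.
move: m; apply: lspan_min => [|m Nm]; last exact: act_span_mem.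
apply/submod_closedP; split=> [|k u v Nu Nv] /=;
  first by rewrite scaler0; exact: lspan0.
by rewrite act_linear; exact: lspanZD.
Qed.

Variable s : seq A.
Local Notation F := (std_filtration s).

Lemma act_filtrationD i j N :
  act_span (F i) (act_span (F j) N) `<=` act_span (F (i + j)%N) N.
Proof.
apply: act_span_min => [|a m Fa Nm]; first exact: lspan_submod.
by apply: act_span_act Nm => b; exact: filtration_monoid.
Qed.

Lemma act_filtration_le i j N : (i <= j)%N ->
  act_span (F i) N `<=` act_span (F j) N.
Proof. by move=> ij; apply: act_span_mono => //; exact: filtration_mono. Qed.

(** Generation is a span over [A], whereas [act_span] is a span over K. The elements reached at some
    finite level form an [A]-submodule containing N, because every scalar of [A] itself has a finite
    level. *)
Lemma act_filtration_exhaust N m : generates_algebra s -> generates_module N ->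
  exists i, act_span (F i) N m.
Proof.
move=> gens genN; have : [set: M] m by []; rewrite -genN; move: m.
pose W : set M := [set m | exists i, act_span (F i) N m].
apply: (@lspan_min A M _ W).
  apply/submod_closedP; split=> [|a u v [i Nu] [j Nv]];
    first by exists 0; exact: lspan0.
  have [k Fa] := filtration_exhaust a gens.
  exists (maxn (k + i) j); apply: lspanD.
    apply: (act_filtration_le (leq_maxl _ _)).
    by apply: act_span_act Nu => b; exact: filtration_monoid.
  exact: act_filtration_le (leq_maxr _ _) _ Nv.
move=> m Nm; exists 0; rewrite -[m](@scale1r A M).
by apply: act_span_mem => //; exact: filtration_one.
Qed.

End ActSpan.

(** * Uniform bounds over finite families *)

Lemma uniform_bound_fin (T : finType) (P : T -> nat -> Prop) :
  (forall t i j, (i <= j)%N -> P t i -> P t j) ->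
  (forall t, exists n, P t n) -> exists n, forall t, P t n.
Proof.
move=> Pmono /fin_all_exists[f Pf]; exists (\max_t f t)%N => t.
exact: Pmono (leq_bigmax t) (Pf t).
Qed.

Lemma uniform_bound_seq (T : eqType) (r : seq T) (P : T -> nat -> Prop) :
  (forall t i j, (i <= j)%N -> P t i -> P t j) ->
  (forall t, exists n, P t n) -> exists n, forall t, t \in r -> P t n.
Proof.
move=> Pmono Pex; elim: r => [|t r [n Pn]]; first by exists 0.
have [k Pk] := Pex t; exists (maxn k n) => u; rewrite inE => /predU1P[->|ur].
  exact: Pmono (leq_maxl _ _) Pk.
exact: Pmono (leq_maxr _ _) (Pn _ ur).
Qed.

(** * Families of maps that intertwine two actions through matrices *)

Section TwistedFamily.
Variables (K : fieldType) (C C' : algType K)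
  (M : lmodType C) (M' : lmodType C').
Variable T : finType.
Local Notation MK := (restrict_scalars M).
Local Notation MK' := (restrict_scalars M').
Local Notation act a m := ((a : C) *: ((m : MK) : M) : MK).
Local Notation act' a m := ((a : C') *: ((m : MK') : M') : MK').

(** The column of maps [phi t] intertwines c with a matrix over [C']. No single [phi t] need be a
    module map, but the whole family behaves like one. *)
Definition twisted_by (phi : T -> MK -> MK') (c : C) (alpha : T -> T -> C') :=
  forall t m, phi t (act c m) = \sum_u act' (alpha t u) (phi u m).

Definition twisted_family (phi : T -> MK -> MK') :=
  (forall t, linear (phi t)) /\ forall c, exists alpha, twisted_by phi c alpha.

Definition family_image (phi : T -> MK -> MK') (N : set MK) : set MK' :=
  [set phi t m | t in [set: T] & m in N].

Variables (phi : T -> MK -> MK') (s : seq C) (s' : seq C').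
Hypotheses (phiP : twisted_family phi) (gens' : generates_algebra s').
Local Notation F := (std_filtration s).
Local Notation F' := (std_filtration s').

Lemma twisted_family0 t : phi t 0 = 0.
Proof. by have [/(_ t (-1) 0 0)] := phiP; rewrite !scaleN1r !addNr. Qed.

(** Measures how deep in [F'] the matrix entries for c must lie. The next three facts make D an
    increasing exhaustive filtration by subspaces, so a single level contains all of A_1. *)
Let D n : set C := [set c | exists2 alpha,
  (forall t u, F' n (alpha t u)) & twisted_by phi c alpha].

Let D_submod n : GRing.submod_closed (mem (D n)).
Proof.
apply/submod_closedP; split=> [|k a b [al Fal tal] [be Fbe tbe]].
  exists (fun _ _ => 0) => [t u|t m]; first exact: lspan0.
  by rewrite scale0r twisted_family0 big1 // => u _; exact: (@scale0r C' M').
exists (fun t u => k *: al t u + be t u) => [t u|t m].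
  by apply: lspanZD; [exact: Fal|exact: Fbe].
have [phil _] := phiP.
rewrite act_linearl phil tal tbe scaler_sumr -big_split /=.
by apply: eq_bigr => u _; rewrite -act_linearl.
Qed.

Let D_mono i j : (i <= j)%N -> D i `<=` D j.
Proof.
by move=> ij c [al Fal tal]; exists al => // t u; exact: filtration_mono ij _ _.
Qed.

Let D_exhaust c : exists n, D n c.
Proof.
have [_ /(_ c)[al tal]] := phiP.
have [] := @uniform_bound_fin (T * T)%type (fun p n => F' n (al p.1 p.2)).
- by move=> p i j ij; exact: filtration_mono.
- by move=> p; exact: filtration_exhaust.
- by move=> n Fn; exists n, al => // t u; exact: (Fn (t, u)).
Qed.

(** If every element of A_1 has a matrix with entries in [F' k], a product of n such elements is
    intertwined with the product of n matrices, whose entries lie in [F' (k * n)]. The constant k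
    depends neither on n nor on N. *)
Lemma twisted_filtration : exists2 k, (0 < k)%N & forall n N t m,
  act_span (F n) N m -> act_span (F' (k * n)) (family_image phi N) (phi t m).
Proof.
have [] := @uniform_bound_seq C (1 :: s) (fun c n => D n c).
- by move=> c i j ij; exact: D_mono.
- exact: D_exhaust.
(* The successor makes k positive, as the slope in [degree_inf_le] must be. *)
move=> k0 Dk0; pose k := k0.+1; exists k => // n N t m.
have A1D : lspan (1 |` [set` s]) `<=` D k.
  apply: lspan_min (D_submod _) _ => c sc; apply: (D_mono (leqnSn _)).
  by apply: Dk0; rewrite inE; case: sc => [->|/= ->]; rewrite ?eqxx ?orbT.
have [phil _] := phiP.
move: m; apply: act_span_min => [|a m Fa Nm].
  apply/submod_closedP; split=> [|x u v Nu Nv] /=;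
    first by rewrite twisted_family0; exact: lspan0.
  by rewrite phil; exact: lspanZD.
move: a Fa; apply: lspan_min.
  apply/submod_closedP; split=> [|x u v Nu Nv] /=.
    by rewrite scale0r twisted_family0; exact: lspan0.
  by rewrite act_linearl phil; exact: lspanZD.
(* The index t varies in the induction: peeling off one factor passes from t to all indices v. *)
move=> _ [u /= A1u <-]; elim: n u A1u t => [|n IHn] u A1u t.
  rewrite big_ord0 scale1r -[phi t m](@scale1r C' M').
  by apply: act_span_mem; [exact: filtration_one|exists t => //; exists m].
rewrite big_ord_recl -scalerA; have [al Fal tal] := A1D _ (A1u ord0).
rewrite tal mulnS; apply: lspan_sum => v _.
apply: (act_span_act (T := F' (k * n)%N)) => [b|];
  first exact: filtration_monoid.
by apply: IHn => j; exact: A1u.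
Qed.

Lemma generates_family_image (N : set MK) : generates_module N ->
  (forall m', lspan (family_image phi setT : set M') m') ->
  generates_module (family_image phi N).
Proof.
move=> genN gen'; apply/seteqP; split=> // m' _.
apply: lspan_min m' (gen' m') => [|_ [t _ [m _ <-]]]; first exact: lspan_submod.
have : [set: M] m by []; rewrite -genN => Nm; move: m Nm t.
(* Quantifying over all t at once makes W stable under [C], since [phi t (act a m)] involves every
   [phi u m]. *)
pose W : set M :=
  [set m | forall t, lspan (family_image phi N : set M') (phi t m)].
have [phil phit] := phiP.
have phiD u x y : phi u (x + y) = phi u x + phi u y.
  by have := phil u 1 x y; rewrite !scale1r.
apply: (@lspan_min C M _ W).
  apply/submod_closedP; split=> [t|a u v Wu Wv t];
    first by rewrite twisted_family0; exact: lspan0.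
  have -> : phi t (act a u + v) = phi t (act a u) + phi t v by exact: phiD.
  have [al ->] := phit a; apply: (@lspanD C' M') (Wv t).
  by apply: (@lspan_sum C' M') => x _; exact: (@lspanZ C' M').
by move=> m Nm t; apply: (@sub_lspan C' M'); exists t => //; exists m.
Qed.

End TwistedFamily.

(** A common level for the finitely many spanning vectors contains their whole span. *)
Lemma fin_dim_exhaust (K : fieldType) (A : algType K) (M : lmodType A)
    (N : set (restrict_scalars M)) (W : nat -> set (restrict_scalars M)) :
  fin_dim N -> (forall n, GRing.submod_closed (mem (W n))) ->
  (forall i j, (i <= j)%N -> W i `<=` W j) -> (forall m, exists n, W n m) ->
  exists n, N `<=` W n.
Proof.
move=> [r ->] Wc Wmono Wex.
have [|//|n Wn] := @uniform_bound_seq _ r (fun m n => W n m).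
  by move=> m i j ij; exact: Wmono.
by exists n; apply: lspan_min.
Qed.

(** * Transfer of return functions along a pair of twisted families *)

Section Transfer.
Variables (R : realType) (K : fieldType) (C C' : algType K).
Variables (M : lmodType C) (M' : lmodType C') (T T' : finType).
Local Notation MK := (restrict_scalars M).
Local Notation MK' := (restrict_scalars M').
Local Notation act a m := ((a : C) *: ((m : MK) : M) : MK).
Variables (phi : T -> MK -> MK') (psi : T' -> MK' -> MK).
Hypotheses (phiP : twisted_family phi) (psiP : twisted_family psi).
Hypothesis psi_phi : forall t u, exists c, forall m, psi t (phi u m) = act c m.
Hypothesis phi_inj : forall m, (forall t, phi t m = 0) -> m = 0.
Hypothesis psi_gen : forall m, lspan (family_image psi setT : set M) m.
Hypothesis simpleM' : forall m' : M', m' != 0 ->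
  generates_module (lspan [set (m' : MK')]).
Hypothesis nontrivialM : exists m : M, m != 0.

Lemma generates_nonzero (N : set MK) : generates_module N ->
  exists2 m, N m & m != 0.
Proof.
move=> genN; apply: contrapT => N0; have [m /eqP] := nontrivialM; apply.
have : [set: M] m by []; rewrite -genN; apply: (@lspan_min C M _ [set 0]).
  by apply/submod_closedP; split=> // a u v /= -> ->; rewrite scaler0 addr0.
by move=> n Nn; apply: contrapT => /eqP n0; apply: N0; exists n.
Qed.

(** A generating subspace N of M_i contains some m with [phi t m] nonzero. This vector lies at level
    k*i+b of [M'] and generates [M'], so [M0'] is recovered from it in j steps; applying psi brings
    the inclusion back to M and recovers [M0] from m in k'*j+h+e steps. *)
Lemma degree_transfer (s : seq C) (s' : seq C') (M0 : set MK) (M0' : set MK') :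
  generates_algebra s -> generates_algebra s' ->
  fin_dim M0 -> generates_module M0' ->
  (degree (return_function R (std_filtration s) M0) <=
   degree (return_function R (std_filtration s') M0'))%E.
Proof.
move=> gens gens' finM0 genM0'.
pose F := std_filtration s; pose F' := std_filtration s'.
have [k k_gt0 phiF] := twisted_filtration s phiP gens'.
have [k' _ psiF] := twisted_filtration s' psiP gens.
have [phil _] := phiP.
(* b bounds the level of the images of [M0] relative to [M0']. *)
have [b M0b] : exists n, M0 `<=`
  [set m | forall t, act_span (F' n) M0' (phi t m)].
  apply: fin_dim_exhaust => // [n|i j ij m Wm t|m].
  - apply/submod_closedP; split=> [t|a u v Wu Wv t];
      first by rewrite (twisted_family0 phiP); exact: lspan0.
    by rewrite phil; apply: lspanZD; [exact: Wu|exact: Wv].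
  - exact: act_filtration_le ij _ (Wm t).
  - apply: uniform_bound_fin => [t i j ij|t]; first exact: act_filtration_le.
    exact: act_filtration_exhaust.
(* The images of [M0'] under psi generate M; h is the number of steps in which they recover [M0]. *)
have [h M0h] : exists n, M0 `<=` act_span (F n) (family_image psi M0').
  apply: fin_dim_exhaust => // [n|i j ij|m]; first exact: lspan_submod.
    exact: act_filtration_le.
  apply: act_filtration_exhaust => //; exact: generates_family_image.
(* e bounds the level of the elements of C by which the composites of psi and phi act. *)
have [e psi_phi_e] :
  exists n, forall p m, act_span (F n) [set m] (psi p.1 (phi p.2 m)).
  apply: uniform_bound_fin => [[t u] i j ij Wi m|[t u]].
    exact: act_filtration_le ij _ (Wi m).
  have [c psi_phic] := psi_phi t u; have [n Fc] := filtration_exhaust c gens.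
  by exists n => m; rewrite /= psi_phic; exact: act_span_mem.
apply: (@degree_inf_le R _ _ k b k' (h + e)) => // i j retj N Nsub Ni genN.
have [m Nm m0] := generates_nonzero genN.
have [t phim0] : exists t, phi t m != 0.
  apply: contrapT => phim; move/eqP: m0; apply; apply: phi_inj => t.
  by apply: contrapT => /eqP phim0; apply: phim; exists t.
have M0'j : M0' `<=` act_span (F' j) [set phi t m].
  apply: subset_trans (@act_span_lspan _ _ _ _ _).
  apply: retj (simpleM' phim0); first exact: lspan_submod.
  apply: lspan_min; first exact: lspan_submod.
  move=> _ ->; apply: act_filtrationD.
  apply: act_span_mono (phiF _ _ t _ (Ni _ Nm)) => // _ [u _ [n M0n <-]].
  exact: M0b.
(* The three levels add up: h to reach [M0] from psi of [M0'], k'*j to reach the latter from the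
   vectors [psi v (phi t m)], and e to reach these from m. *)
apply: (subset_trans M0h).
apply: (@subset_trans _ (act_span (F (h + (k' * j + e))%N) [set m]));
  last first.
  by rewrite addnCA; apply: act_span_mono => // _ ->.
apply: subset_trans (@act_filtrationD _ _ _ _ _ _ _).
apply: act_span_mono => // _ [u _ [m' M0m' <-]].
apply: act_filtrationD; apply: act_span_mono (psiF _ _ u _ (M0'j _ M0m')) => //.
by move=> _ [v _ [_ -> <-]]; exact: (psi_phi_e (v, t)).
Qed.

End Transfer.

(** * Enveloping algebras and the regular bimodule *)

(** Reversing the multiplication does not change which subsets are subalgebras. *)
Lemma generates_algebra_conv (K : fieldType) (A : algType K) (s : seq A) :
  generates_algebra s -> generates_algebra (s : seq A^c).
Proof.
move=> gens; apply/seteqP; split=> // a _ S [[S1 Sl SM] sS].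
have : [set: A] a by []; rewrite -gens; apply; split=> //.
split=> // x y Sx Sy; exact: SM.
Qed.

(** Every pure tensor factors as [pure_tensor a 1 * pure_tensor 1 b], and each factor is reached
    from the generators of one side. *)
Lemma generates_tensor (K : fieldType) (A B : algType K)
    (s : seq A) (r : seq B) :
  generates_algebra s -> generates_algebra r ->
  generates_algebra
    ([seq pure_tensor a 1 | a <- s] ++ [seq pure_tensor 1 b | b <- r]
    : seq (tensor A B)).
Proof.
move=> gens genr; apply/seteqP; split=> // t _ S [[S1 Sl SM] sS].
have bil := @pure_tensor_bilinear K A B.
have Sl' k u v : S u -> S v -> S (k *: u + v).
  by have := Sl k u v; rewrite !inE; apply.
have SM' u v : S u -> S v -> S (u * v) by have := SM u v; rewrite !inE; apply.
have S1' : S 1 by have := S1; rewrite inE.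
have S0 : S 0 by have := Sl' (-1) 1 1 S1' S1'; rewrite scaleN1r addNr.
have SA a : S (pure_tensor a 1).
  have : [set: A] a by []; rewrite -gens; move: a.
  apply: (@smallest_sub _ _ _ [set a : A | S (pure_tensor a 1)]) => [|a sa].
    split=> [|k a b|a b]; rewrite !inE => //= Sa Sb.
      by have /= -> := bil.1 1 k a b; exact: Sl'.
    by have := SM' _ _ Sa Sb; rewrite pure_tensorM mulr1.
  by apply: sS; rewrite /= mem_cat (map_f (pure_tensor^~ 1)).
have SB b : S (pure_tensor 1 b).
  have : [set: B] b by []; rewrite -genr; move: b.
  apply: (@smallest_sub _ _ _ [set b : B | S (pure_tensor 1 b)]) => [|b sb].
    split=> [|k a b|a b]; rewrite !inE => //= Sa Sb.
      by have /= -> := bil.2 1 k a b; exact: Sl'.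
    by have := SM' _ _ Sa Sb; rewrite pure_tensorM mulr1.
  by apply: sS; rewrite /= mem_cat (map_f (pure_tensor 1)) ?orbT.
rewrite [t]tensor_sum_pure; elim/big_ind: _ => // [u v Su Sv|p _].
  by rewrite -[u]scale1r; exact: Sl'.
by have := SM' _ _ (SA p.1) (SB p.2); rewrite pure_tensorM mulr1 mul1r.
Qed.

Section RegularBimoduleFacts.
Variables (K : fieldType) (A : algType K).
Local Notation AA := (bimod_alg A A).
Local Notation M := (regular_bimodule A).

Lemma pure_tensor_regular (a : A) (b : A^c) (x : M) :
  pure_tensor a b *: x = (a * (x : A) * (b : A) : A) :> M.
Proof. exact: bimulE. Qed.

(** On the left K acts through multiples of the unit of the enveloping algebra; this has to be
    matched with the scaling of A itself. *)
Lemma restrict_regularZ (k : K) (a : A) :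
  k *: (a : restrict_scalars M) = (k *: a : A).
Proof.
have -> : k *: (a : restrict_scalars M) =
  ((k *: (pure_tensor 1 1 : AA)) *: (a : M)) by [].
have [bil _] := @pure_tensor_bilinear K A A^c.
have /= := bil (1 : A^c) k 1 0.
(* This instance shows that [pure_tensor 0 1] vanishes; the previous one then moves k into the left
   factor. *)
have /= := bil (1 : A^c) (-1) 0 0.
rewrite !scaleN1r !addNr => -> ; rewrite !addr0 => <-.
by rewrite pure_tensor_regular mulr1 -scalerAl mul1r.
Qed.

(** Submodules of the regular bimodule are two-sided ideals, and the one generated by x is
    nonzero. *)
Lemma regular_simple (x : M) : simple_algebra A -> x != 0 ->
  generates_module (lspan [set (x : restrict_scalars M)]).
Proof.
move=> simA x0; set N := lspan _.
have Nx : lspan (N : set M) x by apply: sub_lspan; apply: sub_lspan.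
have [||Neq|//] := simA (lspan (N : set M)).
- split; rewrite ?inE; first exact: lspan0.
  move=> u v; rewrite !inE => Nu Nv.
  by have := lspanZD (-1 : AA) Nv Nu; rewrite scaleN1r addrC.
- move=> a u Nu; split.
    by have := lspanZ (pure_tensor a 1 : AA) Nu;
      rewrite pure_tensor_regular mulr1.
  by have := lspanZ (pure_tensor 1 (a : A^c) : AA) Nu;
    rewrite pure_tensor_regular mul1r.
- by move: Nx x0; rewrite Neq /= => ->; rewrite eqxx.
Qed.

(** Ensures that [xget] returns a genuine value instead of its default [+oo]. The subspace K.1
    serves as generating subspace. *)
Lemma fdim_values_nonempty (R : realType) : fg_algebra A ->
  exists d : \bar R, @fdim_values R K AA M d.
Proof.
move=> [s gens].
have genAA := generates_tensor gens (generates_algebra_conv gens).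
eexists; eexists; exists (lspan [set` [:: (1 : A) : restrict_scalars M]]).
split; [exact: genAA|by eexists| |reflexivity].
apply/seteqP; split=> // a _.
rewrite -[a]mulr1 -[_ * 1]mulr1 -(pure_tensor_regular a 1 1).
by apply: lspanZ; apply: sub_lspan; apply: sub_lspan; rewrite /= inE.
Qed.

End RegularBimoduleFacts.

(** * Bimodules, Morita contexts and the sandwich maps *)

Section BimoduleActions.
Variables (K : fieldType) (A B : algType K) (X : lmodType (bimod_alg A B)).
Implicit Types (a : A) (b : B) (x : X).

Lemma lactM a a' x : lact (a * a') x = lact a (lact a' x).
Proof. by rewrite /lact scalerA pure_tensorM mulr1. Qed.

Lemma lact_ract a x b : lact a (ract x b) = ract (lact a x) b.
Proof. by rewrite /lact /ract !scalerA !pure_tensorM !mulr1 !mul1r. Qed.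

Lemma lactDl a a' x : lact (a + a') x = lact a x + lact a' x.
Proof.
rewrite /lact -scalerDl; congr (_ *: _).
by have /= := (pure_tensor_bilinear A B^c).1 1 1 a a'; rewrite !scale1r.
Qed.

Lemma lact0 x : lact 0 x = 0.
Proof. by apply: (addrI (lact 0 x)); rewrite -lactDl !addr0. Qed.

Lemma lact_suml (I : Type) (r : seq I) (P : pred I) (F : I -> A) x :
  lact (\sum_(i <- r | P i) F i) x = \sum_(i <- r | P i) lact (F i) x.
Proof. by elim/big_rec2: _ => [|i u v _ <-]; rewrite ?lact0 ?lactDl. Qed.

(** Scalars of K cross the tensor sign, so they act equally on both sides. *)
Lemma lact_scalar (k : K) x : lact k%:A x = ract x k%:A.
Proof.
rewrite /lact /ract; congr (_ *: _).
have bf := pure_tensor_bilinear A B^c.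
by rewrite (bilin_scalel bf) -(bilin_scaler bf).
Qed.

End BimoduleActions.

Section MoritaContext.
Variables (K : fieldType) (A B : algType K).
Variables (X : lmodType (bimod_alg A B)) (Y : lmodType (bimod_alg B A)).
Variables (xy : X -> Y -> A) (yx : Y -> X -> B).
Hypothesis ctx : Morita_context xy yx.

Lemma Morita_context_sym : Morita_context yx xy.
Proof. by case: ctx. Qed.

(** The coefficients of a linear combination of pairings are absorbed into the left arguments,
    leaving a plain sum. *)
Lemma pairing_decomposition :
  lspan [set xy x y | x in [set: X] & y in [set: Y]] = [set: A] ->
  exists r : seq (X * Y), \sum_(p <- r) xy p.1 p.2 = 1.
Proof.
move=> gen; have : [set: A] 1 by []; rewrite -gen; move: (1 : A).
have [[_ _ xyl _ _] _ _ _] := ctx.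
apply: (@lspan_min _ _ _
  [set a | exists r : seq (X * Y), \sum_(p <- r) xy p.1 p.2 = a]).
  apply/submod_closedP; split=> [|k _ _ [r <-] [r' <-]];
    first by exists [::]; rewrite big_nil.
  exists ([seq (lact k%:A p.1, p.2) | p <- r] ++ r').
  rewrite big_cat big_map scaler_sumr; congr (_ + _); apply: eq_bigr => p _ /=.
  by rewrite xyl mulr_algl.
by move=> _ [x _ [y _ <-]]; exists [:: (x, y)]; rewrite big_seq1.
Qed.

Variables (I : finType) (x : I -> X) (y : I -> Y).

Definition sandwich (p : I * I) (a : restrict_scalars (regular_bimodule A)) :
  restrict_scalars (regular_bimodule B) := yx (y p.1) (lact (a : A) (x p.2)).

Variable P : pred I.
Hypothesis one_xy : \sum_(i | P i) xy (x i) (y i) = 1.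

Lemma yx0r y0 : yx y0 0 = 0.
Proof.
have [_ [_ yxD _ _ _] _ _] := ctx.
by apply: (addrI (yx y0 0)); rewrite -yxD !addr0.
Qed.

Lemma yx_sumr y0 (J : Type) (r : seq J) (Q : pred J) (F : J -> X) :
  yx y0 (\sum_(j <- r | Q j) F j) = \sum_(j <- r | Q j) yx y0 (F j).
Proof.
have [_ [_ yxD _ _ _] _ _] := ctx.
by elim/big_rec2: _ => [|j u v _ <-]; rewrite ?yx0r ?yxD.
Qed.

Lemma sandwich_linear p : linear (sandwich p).
Proof.
have [_ [_ yxD _ yxr _] _ _] := ctx.
move=> k a b; rewrite !restrict_regularZ /sandwich.
(* K-linearity is not among the axioms of a context: the scalar is put to the right of a, turned
   into a right action on X, and pulled out as an element of B. *)
have -> : (k *: (a : A) : A) = (a : A) * k%:A by rewrite mulr_algr.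
by rewrite lactDl yxD lactM lact_scalar lact_ract yxr mulr_algr.
Qed.

Lemma sandwich_pure i j (p a q : A) :
  yx (y i) (lact (p * a * q) (x j)) =
  \sum_(u | P u) \sum_(v | P v)
    yx (y i) (lact p (x u)) * sandwich (u, v) a * yx (y v) (lact q (x j)).
Proof.
have [_ [_ _ _ yxr _] xyl _] := ctx.
have -> : p * a * q = \sum_(u | P u) \sum_(v | P v)
    p * xy (x u) (y u) * (a * xy (x v) (y v) * q).
  rewrite -[p in LHS]mulr1 -one_xy mulr_sumr !mulr_suml; apply: eq_bigr => u _.
  by rewrite -mulrA -[a in LHS]mulr1 -one_xy mulr_sumr mulr_suml mulr_sumr.
rewrite lact_suml yx_sumr; apply: eq_bigr => u _.
rewrite lact_suml yx_sumr; apply: eq_bigr => v _.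
by rewrite !lactM xyl lact_ract xyl lact_ract !yxr mulrA.
Qed.

Lemma sandwich_twisted : twisted_family sandwich.
Proof.
split=> [p|c]; first exact: sandwich_linear.
(* The matrix is read off from [sandwich_pure]. It vanishes outside P because a twisted family sums
   over all pairs of indices, while the decomposition of 1 runs over P only. *)
pose al (p q : I * I) : bimod_alg B B := if P q.1 && P q.2 then
  \sum_(z <- repr c)
    pure_tensor (yx (y p.1) (lact z.1 (x q.1)))
                (yx (y q.2) (lact (z.2 : A) (x p.2)) : B^c) else 0.
exists al => -[i j] a.
rewrite (eq_bigr (fun q : I * I => if P q.1 && P q.2 then
  \sum_(z <- repr c) yx (y i) (lact z.1 (x q.1)) * sandwich q a *
       yx (y q.2) (lact (z.2 : A) (x j)) else 0 : B)); last first.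
  move=> q _; rewrite /al; case: ifP => _;
    last exact: (@scale0r (bimod_alg B B) (regular_bimodule B)).
  by rewrite scaler_suml; apply: eq_bigr => z _; rewrite pure_tensor_regular.
rewrite -big_mkcond /= /sandwich lact_suml yx_sumr exchange_big;
  apply: eq_bigr => z _ /=.
by rewrite sandwich_pure pair_big.
Qed.

End MoritaContext.

(** * Comparison of filter dimensions across a Morita context *)

Section MoritaTransfer.
Variables (K : fieldType) (A B : algType K).
Variables (X : lmodType (bimod_alg A B)) (Y : lmodType (bimod_alg B A)).
Variables (xy : X -> Y -> A) (yx : Y -> X -> B).
Hypothesis ctx : Morita_context xy yx.
Variables (I : finType) (x : I -> X) (y : I -> Y) (P : pred I).
Hypothesis one_xy : \sum_(i | P i) xy (x i) (y i) = 1.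
Local Notation phi := (sandwich yx x y).
Local Notation psi := (sandwich xy y x).

Lemma sandwich_sandwich p q (a : A) :
  psi p (phi q a) = xy (x p.1) (y q.1) * a * xy (x q.2) (y p.2) :> A.
Proof.
have [[_ _ xyl xyr _] _ _ yxl] := ctx.
by rewrite /sandwich yxl xyr xyl mulrA.
Qed.

(** Each summand is (x_u y_u) a (x_v y_v). This gives both the joint injectivity of phi and the
    generation of A by the images of psi. *)
Lemma sandwich_reconstruct (a : A) :
  \sum_(u | P u) \sum_(v | P v) (psi (u, v) (phi (u, v) a) : A) = a.
Proof.
under eq_bigr => u _ do (under eq_bigr => v _ do rewrite sandwich_sandwich /=;
  rewrite -mulr_sumr one_xy mulr1).
by rewrite -mulr_suml one_xy mul1r.
Qed.

(** Going from A to B inserts a decomposition of 1_A, coming back one of 1_B. Since d and d' come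
    from arbitrary generators and generating subspaces, whichever values [xget] selects are
    covered. *)
Lemma fdim_values_le (R : realType) (Q : pred I) (d d' : \bar R) :
  \sum_(i | Q i) yx (y i) (x i) = 1 -> simple_algebra B ->
  fdim_values (regular_bimodule A) d -> fdim_values (regular_bimodule B) d' ->
  (d <= d')%E.
Proof.
move=> one_yx simB [s [M0 [gens finM0 _ ->]]] [s' [M0' [gens' _ genM0' ->]]].
have ctx' := Morita_context_sym ctx.
have psiP := sandwich_twisted ctx' one_yx.
apply: (@degree_transfer _ _ _ _ _ _ _ _ phi psi) => //.
- exact: sandwich_twisted one_xy.
- move=> p q.
  exists (pure_tensor (xy (x p.1) (y q.1)) (xy (x q.2) (y p.2) : A^c)) => a.
  by rewrite pure_tensor_regular; exact: sandwich_sandwich.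
- move=> a phia; rewrite -[a]sandwich_reconstruct big1 // => u _.
  by rewrite big1 // => v _; rewrite phia (twisted_family0 psiP).
- move=> a; rewrite -[a]sandwich_reconstruct.
  apply: lspan_sum => u _; apply: lspan_sum => v _; apply: sub_lspan.
  by exists (u, v) => //; exists (phi (u, v) a).
- by move=> b; exact: regular_simple.
- by exists (1 : A); exact: oner_neq0.
Qed.

End MoritaTransfer.

Lemma Morita_bases (K : fieldType) (A B : algType K)
    (X : lmodType (bimod_alg A B)) (Y : lmodType (bimod_alg B A))
    (xy : X -> Y -> A) (yx : Y -> X -> B) :
  Morita_context xy yx ->
  lspan [set xy x y | x in [set: X] & y in [set: Y]] = [set: A] ->
  lspan [set yx y x | y in [set: Y] & x in [set: X]] = [set: B] ->
  exists (I : finType) (x : I -> X) (y : I -> Y) (P Q : pred I),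
    \sum_(i | P i) xy (x i) (y i) = 1 /\ \sum_(i | Q i) yx (y i) (x i) = 1.
Proof.
move=> ctx genA genB.
have [r one_xy] := pairing_decomposition ctx genA.
have [r' one_yx] := pairing_decomposition (Morita_context_sym ctx) genB.
(* The disjoint union of the two index sets gives one pair of families x, y for both decompositions;
   P and Q select the two halves. *)
pose t (i : 'I_(size r) + 'I_(size r')) : X * Y := match i with
  | inl i => tnth (in_tuple r) i
  | inr i => let p := tnth (in_tuple r') i in (p.2, p.1) end.
exists ('I_(size r) + 'I_(size r'))%type, (fun i => (t i).1),
  (fun i => (t i).2).
exists (fun i => if i is inl _ then true else false),
  (fun i => if i is inr _ then true else false).
rewrite !big_sumType /= !big_pred0_eq addr0 add0r -one_xy -one_yx.
by rewrite (big_tnth _ _ r) (big_tnth _ _ r').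
Qed.

Theorem theorem1p3 (R : realType) (K : fieldType) (A B : algType K) :
  simple_algebra A -> fg_algebra A ->
  simple_algebra B -> fg_algebra B ->
  Morita_equivalent A B ->
  fdim R A = fdim R B.
Proof.
move=> simA fgA simB fgB [X [Y [xy [yx [ctx genA genB]]]]].
have [I [x [y [P [Q [one_xy one_yx]]]]]] := Morita_bases ctx genA genB.
have dA := xgetPex +oo%E (fdim_values_nonempty R fgA).
have dB := xgetPex +oo%E (fdim_values_nonempty R fgB).
apply: le_anti; apply/andP; split.
  exact: (fdim_values_le ctx one_xy one_yx simB dA dB).
exact: (fdim_values_le (Morita_context_sym ctx) one_yx one_xy simA dB dA).
Qed.
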